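(* There is a universal constant $\varkappa>0$ such that the following holds. Let $d\ge 1$, $\rho>0$, and let $f:[0,1]^d\to\mathbb{R}$ be $\rho$-Lipschitz with respect to the $1$-norm. Then for every $\varepsilon_1>0$ there exists a ReLU neural network $\hat f:[0,1]^d\to\mathbb{R}$ with space and time complexity $\tilde O\big(d(\varkappa\rho d\,\varepsilon_1^{-1}+1)^d\big)$, where $\tilde O$ hides logarithmic factors, such that (a) $\|f-\hat f\|_1\le\varepsilon_1$; and (b) furthermore, if $d\le 3$, $\|f-\hat f\|_\infty\le\varepsilon_1$.
   Context: $f$ is $\rho$-Lipschitz if $|f(\mathbf{x})-f(\mathbf{x}')|\le\rho\|\mathbf{x}-\mathbf{x}'\|_1$ for all $\mathbf{x},\mathbf{x}'$. $\|g\|_1=\int_{[0,1]^d}|g|$ and $\|g\|_\infty=\sup_{[0,1]^d}|g|$. The space complexity of a network is the number of bits needed to store all its parameters; its time complexity is the number of operations in a forward pass.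
   Formalization: The factors hidden by Õ are made explicit as a fixed power of log(2+N+ρ+1/ε₁+|f(0)|), N = d(κρd/ε₁+1)^d; the dependence on |f(0)| is added because a huge constant f needs about log|f(0)| bits, so a space bound in d, ρ, ε₁ alone fails. *)

(* Defs.v *)
From HB Require Import structures.
From mathcomp Require Import all_boot all_order all_algebra.
From mathcomp Require Import all_classical all_reals all_analysis.
Set Implicit Arguments. Unset Strict Implicit. Unset Printing Implicit Defensive.
Import Order.TTheory GRing.Theory Num.Theory.
Local Open Scope ring_scope.

Inductive relu_net : nat -> Type :=
| NOut (n : nat) (w : 'rV[rat]_n) (c : rat) : relu_net n
| NHid (n m : nat) (W : 'M[rat]_(n, m)) (b : 'rV[rat]_m) (rest : relu_net m) :
    relu_net n.

Definition relu {R : realType} (r : R) : R := Num.max r 0.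

Fixpoint net_eval {R : realType} (n : nat) (N : relu_net n) : 'rV[R]_n -> R :=
  match N in relu_net n return 'rV[R]_n -> R with
  | NOut n w c => fun x => \sum_(i < n) ratr (w ord0 i) * x 0 i + ratr c
  | NHid n m W b rest => fun x =>
      net_eval rest (\row_(j < m) relu (\sum_(i < n) x 0 i * ratr (W i j) + ratr (b ord0 j)))
  end.

(* Bit sizes of numbers (binary encodings, sign bit for integers). *)
Definition nat_bits (k : nat) : nat := (trunc_log 2 k).+1.
Definition int_bits (z : int) : nat := (nat_bits `|z|%N).+1.
Definition rat_bits (q : rat) : nat := int_bits (numq q) + int_bits (denq q).

(* Space complexity: total number of bits of all (nonzero) weights, plus all
   biases.  (Zero weights are not stored: sparse storage.) *)
Fixpoint net_space (n : nat) (N : relu_net n) : nat :=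
  match N with
  | NOut n w c => (\sum_(i < n | w ord0 i != 0%R) rat_bits (w ord0 i) + rat_bits c)%N
  | NHid n m W b rest =>
      (\sum_(ij : 'I_n * 'I_m | W ij.1 ij.2 != 0%R) rat_bits (W ij.1 ij.2)
       + \sum_(j < m) rat_bits (b ord0 j) + net_space rest)%N
  end.

(* Time complexity: number of arithmetic operations of a forward pass
   (one multiplication and one addition per nonzero weight, one bias
   addition and one ReLU per hidden neuron, one bias addition at output). *)
Fixpoint net_time (n : nat) (N : relu_net n) : nat :=
  match N with
  | NOut n w c => (2 * #|[set i : 'I_n | w ord0 i != 0%R]| + 1)%N
  | NHid n m W b rest =>
      (2 * #|[set ij : 'I_n * 'I_m | W ij.1 ij.2 != 0%R]| + 2 * m + net_time rest)%N
  end.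

Definition in_cube {R : realType} (d : nat) (x : 'rV[R]_d) : Prop :=
  forall i : 'I_d, 0 <= x 0 i <= 1.

Definition norm1 {R : realType} (d : nat) (x : 'rV[R]_d) : R :=
  \sum_(i < d) `|x 0 i|.

Definition lipschitz_cube {R : realType} (d : nat) (rho : R) (f : 'rV[R]_d -> R) : Prop :=
  forall x y, in_cube x -> in_cube y -> `|f x - f y| <= rho * norm1 (x - y).

Definition vcons {R : realType} (n : nat) (t : R) (y : 'rV[R]_n) : 'rV[R]_n.+1 :=
  \row_(i < n.+1) (if unlift ord0 i is Some j then y 0 j else t).

(* Integral over [0,1]^n of a nonnegative extended-real function, computed
   as an iterated one-dimensional Lebesgue integral (Tonelli). *)
Fixpoint cube_int {R : realType} (n : nat) : ('rV[R]_n -> \bar R) -> \bar R :=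
  match n return ('rV[R]_n -> \bar R) -> \bar R with
  | 0 => fun g => g 0
  | n'.+1 => fun g =>
      (\int[@lebesgue_measure R]_(t in `[0%R, 1%R]%classic)
          cube_int (fun y : 'rV[R]_n' => g (vcons t y)))%E
  end.

Definition L1_cube {R : realType} (d : nat) (g : 'rV[R]_d -> R) : \bar R :=
  cube_int (fun x => (`|g x|)%:E).

(* Main.v *)
(* A rho-Lipschitz function is recovered from its values at the centers v of N^d
   cubic cells, N ~ 4 rho d / eps, by the McShane formula
   max_v (f(v) - rho |x - v|_1): every cone lies below f, and the cone of the
   nearest center is within 2 rho |x - v|_1 <= rho d / N of f(x).  This gives the
   uniform bound in every dimension, hence also the L1 bound.  The maximum is
   computed sequentially, each cone costing O(d) operations on integer weights;
   rounding f(v) and rho to multiples of 1/q, q ~ 4 d / eps, keeps all weights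
   polynomial in 2 + Nc + rho + 1/eps + |f(0)|, i.e. of O(Lg) bits. *)
Require Import Defs.
From HB Require Import structures.
From mathcomp Require Import all_boot all_order all_algebra.
From mathcomp Require Import all_classical all_reals all_analysis.
From mathcomp Require Import ring lra zify.
Import Order.TTheory GRing.Theory Num.Theory.
Local Open Scope ring_scope.

Set Implicit Arguments.
Unset Strict Implicit.
Unset Printing Implicit Defensive.

(** * Counting nonzero entries of block matrices *)

(** A double sum, unlike a cardinal, splits along the blocks of a matrix. *)
Definition nnz m n (W : 'M[rat]_(m, n)) : nat :=
  (\sum_(i < m) \sum_(j < n) (W i j != 0%R))%N.

Lemma card_nnz m n (W : 'M[rat]_(m, n)) :
  #|[set ij : 'I_m * 'I_n | W ij.1 ij.2 != 0]| = nnz W.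
Proof.
rewrite -sum1_card /nnz pair_big /= big_mkcond /=.
by apply: eq_bigr => ij _; rewrite inE; case: (_ != 0).
Qed.

Lemma card_nnz_row n (w : 'rV[rat]_n) :
  #|[set i : 'I_n | w 0 i != 0]| = nnz w.
Proof.
rewrite -sum1_card /nnz big_ord1 big_mkcond /=.
by apply: eq_bigr => i _; rewrite inE; case: (_ != 0).
Qed.

Lemma nnz_row_mx m n1 n2 (A : 'M[rat]_(m, n1)) (B : 'M[rat]_(m, n2)) :
  nnz (row_mx A B) = (nnz A + nnz B)%N.
Proof.
rewrite /nnz -big_split /=; apply: eq_bigr => i _; rewrite big_split_ord /=.
by congr (_ + _)%N; apply: eq_bigr => j _; rewrite ?row_mxEl ?row_mxEr.
Qed.

Lemma nnz_col_mx m1 m2 n (A : 'M[rat]_(m1, n)) (B : 'M[rat]_(m2, n)) :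
  nnz (col_mx A B) = (nnz A + nnz B)%N.
Proof.
rewrite /nnz big_split_ord /=.
by congr (_ + _)%N; apply: eq_bigr => i _; apply: eq_bigr => j _;
  rewrite ?col_mxEu ?col_mxEd.
Qed.

Lemma nnz_le m n (W : 'M[rat]_(m, n)) : (nnz W <= m * n)%N.
Proof.
rewrite /nnz -[X in (_ <= X * _)%N](card_ord m) -sum_nat_const; apply: leq_sum => i _.
rewrite -[X in (_ <= X)%N](card_ord n) -sum1_card; apply: leq_sum => j _.
by case: (_ != 0).
Qed.

Lemma nnz0 m n : nnz (0 : 'M[rat]_(m, n)) = 0%N.
Proof. by rewrite /nnz !big1 // => i _; rewrite big1 // => j _; rewrite mxE eqxx. Qed.

Lemma nnz_scalar n (a : rat) : (nnz (a%:M : 'M[rat]_n) <= n)%N.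
Proof.
rewrite /nnz -[X in (_ <= X)%N](card_ord n) -sum1_card; apply: leq_sum => i _.
rewrite (bigD1 i) //= big1 ?addn0; first by case: (_ != 0).
by move=> j ji; rewrite mxE [i == j]eq_sym (negbTE ji) eqxx.
Qed.

(** * Uniform bit bounds on weights *)

Definition mx_bits b m n (W : 'M[rat]_(m, n)) : Prop :=
  forall i j, (rat_bits (W i j) <= b)%N.

Lemma mx_bits_row b m n1 n2 (A : 'M[rat]_(m, n1)) (B : 'M[rat]_(m, n2)) :
  mx_bits b A -> mx_bits b B -> mx_bits b (row_mx A B).
Proof. by move=> hA hB i j; rewrite mxE; case: fintype.split. Qed.

Lemma mx_bits_col b m1 m2 n (A : 'M[rat]_(m1, n)) (B : 'M[rat]_(m2, n)) :
  mx_bits b A -> mx_bits b B -> mx_bits b (col_mx A B).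
Proof. by move=> hA hB i j; rewrite mxE; case: fintype.split. Qed.

Lemma mx_bits_const b m n (a : rat) :
  (rat_bits a <= b)%N -> mx_bits b (const_mx a : 'M[rat]_(m, n)).
Proof. by move=> ha i j; rewrite mxE. Qed.

Lemma mx_bits_scalar b n (a : rat) :
  (rat_bits 0 <= b)%N -> (rat_bits a <= b)%N -> mx_bits b (a%:M : 'M[rat]_n).
Proof. by move=> h0 ha i j; rewrite mxE; case: (i == j). Qed.

Fixpoint net_bits b n (N : relu_net n) : Prop :=
  match N with
  | NOut _ w c => mx_bits b w /\ (rat_bits c <= b)%N
  | NHid _ _ W c rest => [/\ mx_bits b W, mx_bits b c & net_bits b rest]
  end.

(** Each stored number, be it a nonzero weight or a bias, accounts for at least one operation, so at
    most [net_time N] numbers of at most [b] bits are stored. *)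
Lemma net_space_le b n (N : relu_net n) :
  net_bits b N -> (net_space N <= b * net_time N)%N.
Proof.
elim: N => [{}n w c [hw hc]|{}n m W c rest IH [hW hc /IH hr]] /=.
  have h : (\sum_(i < n | w ord0 i != 0%R) rat_bits (w ord0 i)
      <= #|[set i : 'I_n | w ord0 i != 0%R]| * b)%N.
    rewrite -sum_nat_const; under [leqRHS]eq_bigl do rewrite inE.
    by apply: leq_sum => i _; exact: hw.
  move: h hc; set s := bigop _ _ _; set t := #|_|; nia.
have h1 : (\sum_(ij : 'I_n * 'I_m | W ij.1 ij.2 != 0%R) rat_bits (W ij.1 ij.2)
    <= #|[set ij : 'I_n * 'I_m | W ij.1 ij.2 != 0%R]| * b)%N.
  rewrite -sum_nat_const; under [leqRHS]eq_bigl do rewrite inE.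
  by apply: leq_sum => i _; exact: hW.
have h2 : (\sum_(j < m) rat_bits (c ord0 j) <= m * b)%N.
  rewrite -[X in (_ <= X * _)%N](card_ord m) -sum_nat_const.
  by apply: leq_sum => i _; exact: hc.
move: h1 h2 hr; set s := bigop _ _ _; set t := #|_|; set u := bigop _ _ _; nia.
Qed.

(** * Layers in block form, and the network for a maximum of cones *)

Lemma net_eval_NHid (R : realType) n m (W : 'M[rat]_(n, m)) (c : 'rV_m)
    (rest : relu_net m) (x : 'rV[R]_n) :
  net_eval (NHid W c rest) x =
  net_eval rest (map_mx relu (x *m map_mx ratr W + map_mx ratr c)).
Proof.
rewrite /=; congr net_eval; apply/rowP => j; rewrite !mxE; congr (relu (_ + _)).
by apply: eq_bigr => i _; rewrite mxE.
Qed.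

(** This is how nonnegative data pass through a hidden layer unchanged. *)
Lemma map_relu_id (R : realType) n (x : 'rV[R]_n) :
  (forall i, 0 <= x 0 i) -> map_mx relu x = x.
Proof. by move=> x0; apply/rowP => i; rewrite mxE /relu; apply/max_idPl. Qed.

Section Network.
Variables (d : nat) (n L : int).

(** With the bias [split_b k], the state [(s, r, x)] becomes [(s + r, n x - k, x)] before the
    ReLU. *)
Definition split_W : 'M[rat]_(1 + (1 + d), 1 + (d + d)) :=
  col_mx (row_mx 1%:M 0) (col_mx (row_mx 1%:M 0)
    (row_mx 0 (row_mx (n%:~R)%:M 1%:M))).

Definition split_b (k : 'rV[int]_d) : 'rV[rat]_(1 + (d + d)) :=
  row_mx 0 (row_mx (map_mx (fun z : int => (- z)%:~R) k) 0).

(** Write [u = n x - k]. On input [(S, relu u, x)] the middle column with its bias gives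
    [B - 2 L sum (relu u) + L sum u - S], the sum of [u] being recovered from the carried [x]; this
    is the cone minus [S]. *)
Definition merge_W : 'M[rat]_(1 + (d + d), 1 + (1 + d)) :=
  col_mx (row_mx 1%:M (row_mx (-1)%:M 0))
    (col_mx (row_mx 0 (row_mx (const_mx (- (2 * L))%:~R) 0))
            (row_mx 0 (row_mx (const_mx (L * n)%:~R) 1%:M))).

Definition merge_b (k : 'rV[int]_d) (B : int) : 'rV[rat]_(1 + (1 + d)) :=
  row_mx 0 (row_mx (const_mx (B - L * \sum_(i < d) k 0 i)%:~R) 0).

(* A state (s, r, x) stores the running maximum as s + r; each cone
   B - L |n x - k|_1 is folded in by max S T = S + relu (T - S), using
   |u| = 2 relu u - u. *)
Fixpoint cones_net (vs : seq ('rV[int]_d * int)) (w c : rat) :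
    relu_net (1 + (1 + d)) :=
  if vs is (k, B) :: vs'
  then NHid split_W (split_b k) (NHid merge_W (merge_b k B) (cones_net vs' w c))
  else NOut (row_mx w%:M (row_mx w%:M 0)) c.

(** On nonnegative inputs the first layer produces the state [(0, 0, x)], so the running maximum
    starts at 0. *)
Definition max_cones_net (vs : seq ('rV[int]_d * int)) (w c : rat) : relu_net d :=
  NHid (row_mx 0 (row_mx 0 1%:M)) 0 (cones_net vs w c).

Definition cone (R : realType) (x : 'rV[R]_d) (v : 'rV[int]_d * int) : R :=
  v.2%:~R - L%:~R * \sum_(i < d) `|n%:~R * x 0 i - (v.1 0 i)%:~R|.

Lemma relu_ge0 (R : realType) (r : R) : 0 <= relu r.
Proof. by rewrite /relu le_max lexx orbT. Qed.

Lemma split_eval (R : realType) (s r : R) (x : 'rV[R]_d) k m (N : relu_net m)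
    (W : 'M[rat]_(1 + (d + d), m)) b :
  0 <= s -> 0 <= r -> (forall i, 0 <= x 0 i) ->
  net_eval (NHid split_W (split_b k) (NHid W b N)) (row_mx s%:M (row_mx r%:M x)) =
  net_eval (NHid W b N) (row_mx (s + r)%:M
    (row_mx (\row_i relu (n%:~R * x 0 i - (k 0 i)%:~R)) x)).
Proof.
move=> s0 r0 x0; rewrite net_eval_NHid; congr net_eval.
rewrite /split_W /split_b ?(map_row_mx, map_col_mx, map_scalar_mx, map_mx0).
rewrite !mul_row_col !mul_mx_row !mulmx0 !mul_mx_scalar rmorph1 !scale1r.
rewrite ?(add_row_mx, addr0, add0r) !map_row_mx.
congr row_mx; last congr row_mx.
- rewrite map_relu_id; last first.
    by move=> i; rewrite !mxE !ord1 !mulr1n addr_ge0.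
  by apply/rowP => i; rewrite !mxE mulrnDl.
- by apply/rowP => i; rewrite !mxE ratr_int rmorph_int rmorphN.
- by rewrite map_relu_id.
Qed.

Lemma merge_eval (R : realType) (s : R) (x : 'rV[R]_d) k B (N : relu_net (1 + (1 + d))) :
  0 <= s -> (forall i, 0 <= x 0 i) ->
  net_eval (NHid merge_W (merge_b k B) N) (row_mx s%:M
    (row_mx (\row_i relu (n%:~R * x 0 i - (k 0 i)%:~R)) x)) =
  net_eval N (row_mx s%:M (row_mx (relu (cone x (k, B) - s))%:M x)).
Proof.
move=> s0 x0; rewrite net_eval_NHid; congr net_eval.
rewrite /merge_W /merge_b ?(map_row_mx, map_col_mx, map_scalar_mx, map_mx0, map_const_mx).
rewrite !mul_row_col !mul_mx_row !mulmx0 !mul_mx_scalar rmorph1 !scale1r.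
rewrite ?(add_row_mx, addr0, add0r) !map_row_mx.
congr row_mx; last congr row_mx.
- by rewrite map_relu_id // => i; rewrite mxE !ord1 mulr1n.
- apply/rowP => i; rewrite !mxE !ord1 !mulr1n; congr relu.
  under [X in _ + (X + _)]eq_bigr do rewrite !mxE.
  under [X in _ + (_ + X)]eq_bigr do rewrite mxE.
  rewrite -!mulr_suml !ratr_int rmorphN1 rmorphB rmorphN !rmorphM /= rmorph_sum /=.
  (* Substituting [2 relu u - u] for each absolute value leaves an identity linear in the sums. *)
  rewrite /cone /= [X in _ = _ - _ * X - _](eq_bigr (fun j => 2 * relu (n%:~R * x 0 j - (k 0 j)%:~R)
     - (n%:~R * x 0 j - (k 0 j)%:~R))) => [|j _].
    rewrite !sumrB -!mulr_sumr; ring.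
  rewrite /relu; move: (_ - _) => u.
  by have [u0|/ltW u0] := leP 0 u; [rewrite ger0_norm|rewrite ler0_norm]; try lra.
- by rewrite map_relu_id.
Qed.

(** The induction runs over all [s] and [r], since each cone moves the old maximum into the first
    slot and puts the increment into the second. *)
Lemma cones_net_eval (R : realType) vs w c (s r : R) (x : 'rV[R]_d) :
  0 <= s -> 0 <= r -> (forall i, 0 <= x 0 i) ->
  net_eval (cones_net vs w c) (row_mx s%:M (row_mx r%:M x)) =
  ratr w * foldl (fun t v => Num.max t (cone x v)) (s + r) vs + ratr c.
Proof.
move=> + + x0; elim: vs s r => [|[k B] vs IH] s r s0 r0.
  rewrite /= !big_split_ord /= !big_ord1 big1 ?addr0 => [|i _]; last first.
    by rewrite !row_mxEr !mxE rmorph0 mul0r.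
  by rewrite !row_mxEr !row_mxEl !mxE /= !mulr1n mulrDr.
rewrite [LHS]split_eval // merge_eval ?addr_ge0 // IH ?addr_ge0 ?relu_ge0 //=.
congr (_ * foldl _ _ _ + _); rewrite /relu; case: leP => ?; case: leP => ?; lra.
Qed.

Lemma max_cones_net_eval (R : realType) vs w c (x : 'rV[R]_d) :
  (forall i, 0 <= x 0 i) ->
  net_eval (max_cones_net vs w c) x =
  ratr w * foldl (fun t v => Num.max t (cone x v)) 0 vs + ratr c.
Proof.
move=> x0; rewrite net_eval_NHid !map_row_mx !map_mx0 map_scalar_mx rmorph1.
rewrite addr0 !mul_mx_row !mulmx0 mulmx1 map_relu_id => [|i]; last first.
  by rewrite mxE; case: fintype.split => j; rewrite ?mxE //;
    case: fintype.split => k; rewrite ?mxE.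
(* The zero blocks are rewritten as scalar matrices to match the shape of a state. *)
by rewrite -(raddf0 (@scalar_mx R 1)) cones_net_eval // addr0.
Qed.

(** A split layer costs at most [8 d + 6] operations, a merge layer at most [8 d + 8], and the
    output at most 5. *)
Lemma cones_net_time vs w c :
  (net_time (cones_net vs w c) <= size vs * (16 * d + 14) + 5)%N.
Proof.
elim: vs => [|[k B] vs IH] /=.
  rewrite card_nnz_row !nnz_row_mx nnz0.
  have := nnz_scalar 1 w; lia.
rewrite !card_nnz /split_W /merge_W !(nnz_col_mx, nnz_row_mx, nnz0).
have h (a : rat) := nnz_scalar d a; have h1 (a : rat) := nnz_scalar 1 a.
have hc (a : rat) := nnz_le (const_mx a : 'M[rat]_(d, 1)).
move: (h1 1) (h1 (-1)) (h 1) (h n%:~R) (hc (- (2 * L))%:~R) (hc (L * n)%:~R).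
rewrite muln1 [((size vs).+1 * _)%N]mulSn.
by move: IH; do !move: (nnz _); move: (net_time _) (_ * _)%N; lia.
Qed.

Lemma max_cones_net_time vs w c :
  (net_time (max_cones_net vs w c) <= size vs * (16 * d + 14) + 4 * d + 9)%N.
Proof.
rewrite /= card_nnz !nnz_row_mx !nnz0.
have := cones_net_time vs w c; have := nnz_scalar d 1.
by move: (nnz _) (net_time _) (size _ * _)%N; lia.
Qed.

Lemma max_cones_net_bits (vs : seq ('rV[int]_d * int)) w c b :
  (rat_bits 0 <= b)%N -> (rat_bits 1 <= b)%N -> (rat_bits (-1) <= b)%N ->
  (rat_bits n%:~R <= b)%N ->
  (rat_bits (- (2 * L))%:~R <= b)%N -> (rat_bits (L * n)%:~R <= b)%N ->
  (forall v i, v \in vs -> (rat_bits (- v.1 0 i)%:~R <= b)%N) ->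
  (forall v, v \in vs ->
     (rat_bits (v.2 - L * \sum_(i < d) v.1 0 i)%:~R <= b)%N) ->
  (rat_bits w <= b)%N -> (rat_bits c <= b)%N ->
  net_bits b (max_cones_net vs w c).
Proof.
move=> h0 h1 hN1 hn hL hLn + + hw hc.
have bits0 p q : mx_bits b (0 : 'M[rat]_(p, q)) by move=> i j; rewrite mxE.
move=> hk hB /=; split; rewrite ?/split_W ?/merge_W;
  do ?[exact: bits0 | exact: mx_bits_scalar | apply: mx_bits_row].
elim: vs hk hB => [|[k B] vs IH] hk hB /=.
  by split=> //; do ?[exact: bits0 | exact: mx_bits_scalar | apply: mx_bits_row].
split; [| |split; [| |apply: IH]]; rewrite /split_W /merge_W /split_b /merge_b;
  do ?[exact: bits0 | exact: mx_bits_scalar | apply: mx_bits_row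
      | apply: mx_bits_col | apply: mx_bits_const | done].
- by move=> i j; rewrite mxE ord1; apply: (hk (k, B)); rewrite inE eqxx.
- by apply: (hB (k, B)); rewrite inE eqxx.
- by move=> v i vs_v; apply: hk; rewrite inE vs_v orbT.
- by move=> v vs_v; apply: hB; rewrite inE vs_v orbT.
Qed.

End Network.

(** * Bit lengths of numbers bounded by powers of a common base *)

(** The 4 consists of a leading digit and a sign bit, once for the numerator and once for the
    denominator 1. *)
Lemma rat_bits_int (z : int) (M : nat) :
  (`|z| <= M)%N -> (rat_bits z%:~R <= trunc_log 2 M + 4)%N.
Proof.
move=> /(leq_trunc_log 2); rewrite /rat_bits numq_int denq_int /int_bits /nat_bits.
rewrite absz1 trunc_log1; lia.
Qed.

Lemma rat_bits_natV (q M : nat) :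
  (0 < q)%N -> (q <= M)%N -> (rat_bits q%:R^-1 <= trunc_log 2 M + 4)%N.
Proof.
move=> q0 /(leq_trunc_log 2); have -> : (q%:R^-1 : rat) = 1%:~R / q%:~R.
  by rewrite mul1r.
rewrite /rat_bits coprimeq_num ?coprime1n // mul1r denqVz ?gtr0_sgz //; last lia.
rewrite gtr0_sg ?ltz_nat // /int_bits /nat_bits absz1 trunc_log1 /=; lia.
Qed.

(** As [A >= 2], the factor 2 of a sum costs one more exponent; rounding to an integer below costs
    one for the same reason. *)
Lemma norm_leX_add (R : realType) (A : R) a b (x y : R) :
  2 <= A -> `|x| <= A ^+ a -> `|y| <= A ^+ b ->
  `|x + y| <= A ^+ (maxn a b).+1.
Proof.
move=> A2; have A1 : 1 <= A by lra.
move=> hx hy; apply: (le_trans (ler_normD _ _)).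
have ha : A ^+ a <= A ^+ maxn a b by rewrite ler_weXn2l ?leq_maxl.
have hb : A ^+ b <= A ^+ maxn a b by rewrite ler_weXn2l ?leq_maxr.
rewrite exprS; have : 0 <= A ^+ maxn a b by rewrite exprn_ge0 //; lra.
by move=> h; have := ler_wpM2r h A2; lra.
Qed.

Lemma norm_leX_mul (R : realType) (A : R) a b (x y : R) :
  2 <= A -> `|x| <= A ^+ a -> `|y| <= A ^+ b ->
  `|x * y| <= A ^+ (a + b).
Proof.
move=> A2; have A1 : 1 <= A by lra.
by move=> hx hy; rewrite normrM exprD ler_pM.
Qed.

Lemma norm_leX_weak (R : realType) (A : R) a b (x : R) :
  2 <= A -> (a <= b)%N -> `|x| <= A ^+ a -> `|x| <= A ^+ b.
Proof.
move=> A2; have A1 : 1 <= A by lra.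
by move=> ab /le_trans; apply; rewrite ler_weXn2l.
Qed.

Lemma norm_floor_leX (R : realType) (A : R) a (x : R) :
  2 <= A -> `|x| <= A ^+ a ->
  `|(Num.floor x)%:~R : R| <= A ^+ a.+1.
Proof.
move=> A2; have A1 : 1 <= A by lra.
move=> hx; rewrite exprS.
have A0 : 1 <= A ^+ a by rewrite exprn_ege1.
have h2 : 2 * A ^+ a <= A * A ^+ a by rewrite ler_wpM2r //; lra.
have /andP[] := floor_itv x; rewrite intrD.
move: hx; rewrite !ler_norml => /andP[h1 h3] h4 h5; apply/andP; split; lra.
Qed.

Lemma norm_truncnS_leX (R : realType) (A : R) a (x : R) :
  2 <= A -> 0 <= x -> `|x| <= A ^+ a ->
  `|(Num.truncn x).+1%:R : R| <= A ^+ a.+1.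
Proof.
move=> A2; have A1 : 1 <= A by lra.
move=> x0 hx; rewrite exprS.
have A0 : 1 <= A ^+ a by rewrite exprn_ege1.
have h2 : 2 * A ^+ a <= A * A ^+ a by rewrite ler_wpM2r //; lra.
have := truncn_le x; rewrite x0 => h.
move: hx; rewrite normr_nat -natr1 ger0_norm //; lra.
Qed.

Lemma rat_bits_int_leX (R : realType) (A : R) p (z : int) :
  2 <= A -> `|z%:~R : R| <= A ^+ p ->
  (rat_bits z%:~R <= trunc_log 2 (Num.truncn (A ^+ p)) + 4)%N.
Proof.
move=> A2; have A1 : 1 <= A by lra.
move=> hz; apply: rat_bits_int; rewrite truncn_ge_nat ?exprn_ge0 //; last lra.
by rewrite natr_absz intr_norm.
Qed.

Lemma rat_bits_natV_leX (R : realType) (A : R) p (q : nat) :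
  2 <= A -> (0 < q)%N -> `|q%:R : R| <= A ^+ p ->
  (rat_bits q%:R^-1 <= trunc_log 2 (Num.truncn (A ^+ p)) + 4)%N.
Proof.
move=> A2; have A1 : 1 <= A by lra.
move=> q0; rewrite normr_nat => hq; apply: rat_bits_natV => //.
by rewrite truncn_ge_nat ?exprn_ge0 //; lra.
Qed.

(** The inequality [ln (1 + t) <= t] at [t = - 1 / 2]. *)
Lemma ln2_ge_half (R : realType) : 1 / 2 <= ln 2 :> R.
Proof.
have : ln (1 + (- 2^-1)) <= - 2^-1 :> R by apply: le_ln1Dx; lra.
have -> : 1 + (- 2^-1) = 2^-1 :> R by lra.
rewrite lnV ?posrE //; lra.
Qed.

Lemma trunc_log2_leX (R : realType) (A : R) p :
  2 <= A ->
  (trunc_log 2 (Num.truncn (A ^+ p)))%:R <= (2 * p)%:R * ln A :> R.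
Proof.
move=> A2; have A1 : 1 <= A by lra.
have Ap : 1 <= A ^+ p by rewrite exprn_ege1.
have h := trunc_logP (isT : (1 < 2)%N) (n := Num.truncn (A ^+ p)).
have {}h : (2 ^ trunc_log 2 (Num.truncn (A ^+ p)) <= Num.truncn (A ^+ p))%N.
  by apply: h; rewrite truncn_gt0.
move: h; rewrite truncn_ge_nat; last lra.
have A0 : 0 < A by lra.
rewrite natrX => h.
have {h} : ln (2 ^+ trunc_log 2 (Num.truncn (A ^+ p))) <= ln (A ^+ p) :> R.
  by rewrite ler_ln ?posrE ?exprn_gt0.
rewrite !lnXn //.
set t := trunc_log _ _; rewrite -[_ *+ t]mulr_natl -[_ *+ p]mulr_natl natrM => h.
have := ler_wpM2l (ler0n R t) (ln2_ge_half R); move: h; lra.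
Qed.

(** * Uniform bounds on iterated integrals *)

(* Unlike [ge0_le_integral], no measurability: the integral of a nonnegative
   function is a supremum over the simple functions below it. *)
Lemma ge0_le_integral_nomeas (d : measure_display) (T : measurableType d)
    (R : realType) (mu : {measure set T -> \bar R}) (D : set T) (f g : T -> \bar R) :
  (forall x, D x -> (0 <= f x)%E) -> (forall x, D x -> (f x <= g x)%E) ->
  (\int[mu]_(x in D) f x <= \int[mu]_(x in D) g x)%E.
Proof.
move=> f0 fg; have g0 x : D x -> (0 <= g x)%E.
  by move=> Dx; exact: le_trans (f0 x Dx) (fg x Dx).
rewrite !ge0_integralE //; apply: ereal_sup_le => _ [h hf <-].
exists h => // x; apply: le_trans (hf x) _.
by rewrite /patch; case: ifPn => // /set_mem /fg.
Qed.

Lemma in_cube_vcons (R : realType) n (t : R) (y : 'rV[R]_n) :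
  0 <= t <= 1 -> in_cube y -> in_cube (vcons t y).
Proof. by move=> ht hy i; rewrite mxE; case: unliftP. Qed.

(** Induction on the dimension: the inner integral lies between 0 and [c], and a constant integrates
    to itself over the unit interval. *)
Lemma cube_int_le (R : realType) n (g : 'rV[R]_n -> \bar R) (c : R) :
  (forall x, in_cube x -> (0 <= g x)%E /\ (g x <= c%:E)%E) ->
  (0 <= cube_int g)%E /\ (cube_int g <= c%:E)%E.
Proof.
elim: n g => [|n IH] g hg /=; first by apply: hg => -[].
have h t : `[0%R, 1%R]%classic t ->
    (0 <= cube_int (fun y => g (vcons t y)))%E /\
    (cube_int (fun y => g (vcons t y)) <= c%:E)%E.
  rewrite /= in_itv /= => ht; apply: IH => y hy.
  by apply: hg; exact: in_cube_vcons.
split; first by apply: integral_ge0 => t /h[].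
apply: (@le_trans _ _ (\int[@lebesgue_measure R]_(t in `[0%R, 1%R]%classic) (cst c%:E) t)%E).
  by apply: ge0_le_integral_nomeas => t /h[].
by rewrite integral_cst //= lebesgue_measure_itv /= lte_fin ltr01 sube0 mule1.
Qed.

(** * Maxima as left folds *)

Lemma le_foldl_max (R : realType) (T : Type) (g : T -> R) (vs : seq T) (s : R) :
  s <= foldl (fun t v => Num.max t (g v)) s vs.
Proof. by elim: vs s => //= v vs IH s; apply: le_trans (IH _); rewrite le_max lexx. Qed.

Lemma foldl_max_ge (R : realType) (T : eqType) (g : T -> R) (vs : seq T) (s : R) v :
  v \in vs -> g v <= foldl (fun t v => Num.max t (g v)) s vs.
Proof.
elim: vs s => //= u vs IH s; rewrite inE => /orP[/eqP <-|]; last exact: IH.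
by apply: le_trans (le_foldl_max _ _ _); rewrite le_max lexx orbT.
Qed.

Lemma foldl_max_le (R : realType) (T : eqType) (g : T -> R) (vs : seq T) (s M : R) :
  s <= M -> (forall v, v \in vs -> g v <= M) ->
  foldl (fun t v => Num.max t (g v)) s vs <= M.
Proof.
elim: vs s => //= u vs IH s sM hM; apply: IH => [|v vs_v].
  by rewrite ge_max sM hM ?inE ?eqxx.
by apply: hM; rewrite inE vs_v orbT.
Qed.

(** * The grid of cell centers and its network *)

Section Grid.
Variables (R : realType) (d N' : nat).
Let N := N'.+1.

(* The cell with index [j] of the subdivision of the cube into [N ^ d] cells has
   center [center j / (2 N)]. *)
Definition center (j : {ffun 'I_d -> 'I_N}) : 'rV[int]_d :=
  \row_i (2 * j i + 1)%N%:Z.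

Definition center_pt (j : {ffun 'I_d -> 'I_N}) : 'rV[R]_d :=
  \row_i ((2 * j i + 1)%N%:R / (2 * N)%N%:R).

Lemma in_cube_center j : in_cube (center_pt j).
Proof.
move=> i; rewrite mxE divr_ge0 //= ler_pdivrMr ?ltr0n // mul1r ler_nat.
have := ltn_ord (j i); rewrite /N; lia.
Qed.

Lemma norm1_center (x : 'rV[R]_d) j :
  \sum_(i < d) `|(2 * N)%N%:Z%:~R * x 0 i - (center j 0 i)%:~R|
  = (2 * N)%N%:R * norm1 (x - center_pt j).
Proof.
rewrite /norm1 mulr_sumr; apply: eq_bigr => i _; rewrite !mxE.
have n0 : 0 < (2 * N)%N%:R :> R by rewrite ltr0n.
rewrite -[X in _ = X * _](gtr0_norm n0) -normrM; congr `|_|.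
by rewrite -!pmulrn mulrBr mulrCA divff ?mulr1 ?gt_eqF.
Qed.

Lemma exists_center (x : 'rV[R]_d) : in_cube x ->
  exists j, (2 * N)%N%:R * norm1 (x - center_pt j) <= d%:R.
Proof.
(* The cell index is the truncation of [N x_i], capped at [N'] so that [x_i = 1] falls into the last
   cell. *)
move=> hx; exists [ffun i => inord (minn (Num.truncn (N%:R * x 0 i)) N')].
rewrite -norm1_center -[X in _ <= X%:R](card_ord d) -sum1_card natr_sum.
apply: ler_sum => i _; rewrite mxE ffunE inordK ?ltnS ?geq_minr //.
have /andP[x0 x1] := hx i.
have Nx0 : 0 <= N%:R * x 0 i by rewrite mulr_ge0.
have /andP[] := truncn_itv Nx0; set t := Num.truncn _.
rewrite -!pmulrn natrD !natrM -mulrA ler_norml -natr1.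
have : N%:R * x 0 i <= N%:R by rewrite ler_piMr.
move: (N%:R * x 0 i) => y; rewrite /N -natr1 => yN ty yt.
case: (leqP t N') => tN; first by apply/andP; split; lra.
(* In the capped case [N x_i] equals [N]. *)
have tN' : N'%:R + 1 <= t%:R :> R by rewrite natr1 ler_nat.
by apply/andP; split; lra.
Qed.

(** The cones approximate [f - Z] scaled by [2 N q], which makes hidden weights and biases integers;
    the output layer undoes scaling and shift. The shift by [Z], a lower bound of [f], makes the
    initial maximum 0 harmless. *)
Definition grid_net (f : 'rV[R]_d -> R) (q : nat) (L Z : int) : relu_net d :=
  max_cones_net (2 * N)%N L
    [seq (center j, (2 * N)%N%:Z * (Num.floor (q%:R * f (center_pt j)) - q%:Z * Z))
      | j <- enum {ffun 'I_d -> 'I_N}]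
    (q * (2 * N))%N%:R^-1 Z%:~R.

(** Heights are rounded down and the slope [L / q] is at least [rho], so all cones stay below [f]
    and the error is one-sided. At distance [m <= d / (2 N)] from the nearest center the loss is at
    most [2 rho m + 1 / q + m / q], and each term is at most [eps / 4]. *)
Lemma grid_net_approx (f : 'rV[R]_d -> R) (rho eps : R) (q : nat) (L Z : int) x :
  (0 < d)%N -> 0 < rho -> lipschitz_cube rho f -> 0 < eps ->
  4 * d%:R <= q%:R * eps -> 4 * rho * d%:R <= N%:R * eps ->
  rho * q%:R <= L%:~R <= rho * q%:R + 1 ->
  Z%:~R <= f 0 - rho * d%:R -> in_cube x ->
  0 <= f x - net_eval (grid_net f q L Z) x <= eps.
Proof.
move=> d0 rho0 flip eps0 hq hN /andP[L1 L2] hZ hx.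
have d1 : 1 <= d%:R :> R by rewrite ler1n.
have q0 : 0 < q%:R :> R.
  by rewrite -(pmulr_lgt0 _ eps0); lra.
have n2 : (2 * N)%N%:R = 2 * N%:R :> R by rewrite natrM.
have n1 : 1 <= (2 * N)%N%:R :> R by rewrite ler1n.
rewrite max_cones_net_eval => [|i]; last by case/andP: (hx i).
set F := foldl _ _ _; set n := (2 * N)%N%:R : R.
have qn0 : 0 < q%:R * n by rewrite mulr_gt0 //; lra.
have -> : ratr (q * (2 * N))%N%:R^-1 * F + ratr Z%:~R = F / (q%:R * n) + Z%:~R.
  by rewrite fmorphV rmorph_nat ratr_int natrM mulrC.
suff [h1 h2] : F <= (q%:R * n) * (f x - Z%:~R) /\
    (q%:R * n) * (f x - Z%:~R - eps) <= F.
  have {}h1 : F / (q%:R * n) <= f x - Z%:~R by rewrite ler_pdivrMr // mulrC.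
  have {}h2 : f x - Z%:~R - eps <= F / (q%:R * n) by rewrite ler_pdivlMr // mulrC.
  by apply/andP; split; lra.
have coneE j : cone (2 * N)%N L x (center j, (2 * N)%N%:Z *
      (Num.floor (q%:R * f (center_pt j)) - q%:Z * Z)) =
    n * ((Num.floor (q%:R * f (center_pt j)))%:~R - q%:R * Z%:~R)
      - L%:~R * (n * norm1 (x - center_pt j)).
  by rewrite /cone norm1_center /= intrM intrB intrM.
split.
- apply: foldl_max_le => [|_ /mapP[j _ ->]].
    (* The initial value 0: [f x >= f 0 - rho d >= Z] on the cube. *)
    apply: mulr_ge0; first exact: ltW.
    have c0 : in_cube (0 : 'rV[R]_d) by move=> i; rewrite mxE lexx ler01.
    have := flip _ _ hx c0; rewrite subr0 => h.
    have hn : norm1 x <= d%:R.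
      rewrite -[X in _ <= X%:R](card_ord d) -sum1_card natr_sum.
      by apply: ler_sum => i _; have /andP[? ?] := hx i; rewrite ger0_norm.
    have := ler_wpM2l (ltW rho0) hn.
    by move: h; rewrite ler_norml => /andP[]; lra.
  rewrite coneE.
  have /andP[fl _] := floor_itv (q%:R * f (center_pt j)).
  have := flip _ _ hx (in_cube_center j); rewrite ler_norml => /andP[h _].
  have m0 : 0 <= norm1 (x - center_pt j) by apply: sumr_ge0.
  move: fl h m0; move: (norm1 _) (f (center_pt j)) (_%:~R : R) => m y Y fl h m0.
  have nn : 0 <= n by lra.
  have e1 := ler_wpM2l nn fl.
  have e2 := ler_wpM2r (mulr_ge0 nn m0) L1.
  have e3 := ler_wpM2l (ltW qn0) h.
  lra.
(* For the lower bound, the cone of the nearest center suffices. *)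
have [j hj] := exists_center hx.
apply: le_trans (foldl_max_ge _ _ (map_f _ (mem_enum _ j))).
rewrite coneE.
have /andP[_ fl] := floor_itv (q%:R * f (center_pt j)).
have := flip _ _ hx (in_cube_center j); rewrite ler_norml => /andP[_ h].
have m0 : 0 <= norm1 (x - center_pt j) by apply: sumr_ge0.
move: hj fl h m0; rewrite -/n intrD.
move: (norm1 _) (f (center_pt j)) (_%:~R : R) => m y Y hj fl h m0.
have nn : 0 <= n by lra.
have e1 := ler_wpM2l nn (ltW fl).
have e2 := ler_wpM2l (mulr_ge0 nn m0) L2.
have e3 := ler_wpM2l (ltW qn0) h.
have e4 : rho * q%:R * (n * m) <= rho * q%:R * d%:R.
  by rewrite ler_wpM2l // mulr_ge0 // ltW.
have e5 := ler_wpM2l (ltW q0) hN.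
have e6 := ler_wpM2l nn hq.
have e7 := ler_wpM2l nn d1.
have e8 : d%:R <= n * d%:R by rewrite ler_peMl //; lra.
have e9 : n = 2 * N%:R by [].
have e10 : q%:R * (N%:R * eps) = q%:R * n * eps / 2 by rewrite e9; field.
nra.
Qed.

(** Each of 16, 14, 4 and 9 in the operation count multiplies a quantity at most [d N ^ d], and they
    add up to 43. *)
Lemma grid_net_time f q L Z : (0 < d)%N ->
  (net_time (grid_net f q L Z) <= 43 * (d * N ^ d))%N.
Proof.
move=> d0; apply: leq_trans (max_cones_net_time _ _ _ _ _) _.
rewrite size_map -cardE card_ffun !card_ord.
have : (0 < N ^ d)%N by rewrite expn_gt0.
move: (N ^ d)%N => e e0.
have h1 : (e <= d * e)%N by rewrite leq_pmull.
have h2 : (d <= d * e)%N by rewrite leq_pmulr.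
rewrite mulnDr mulnCA [(e * d)%N]mulnC; lia.
Qed.

(** The exponent 13 comes from the largest entry, the merge bias: the scaled height is at most
    [A ^ 12], [L] times the sum of center coordinates at most [A ^ 10], and the difference costs one
    more. *)
Lemma grid_net_bits (f : 'rV[R]_d -> R) (rho A : R) (q : nat) (L Z : int) :
  0 < rho -> lipschitz_cube rho f -> 2 <= A ->
  `|d%:R : R| <= A ^+ 1 -> `|N%:R : R| <= A ^+ 1 -> `|rho| <= A ^+ 1 ->
  `|f 0| <= A ^+ 1 -> (0 < q)%N -> `|q%:R : R| <= A ^+ 5 ->
  `|L%:~R : R| <= A ^+ 7 -> `|Z%:~R : R| <= A ^+ 4 ->
  net_bits (trunc_log 2 (Num.truncn (A ^+ 13)) + 4) (grid_net f q L Z).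
Proof.
move=> rho0 flip A2 hd hN hrho hf0 q0 hq hL hZ.
have hn : `|(2 * N)%N%:Z%:~R : R| <= A ^+ 2.
  rewrite -pmulrn natrM; apply: (@norm_leX_mul _ _ 1 1) => //.
  by rewrite expr1 normr_nat.
have B (a : nat) (z : int) : (a <= 13)%N -> `|z%:~R : R| <= A ^+ a ->
    (rat_bits z%:~R <= trunc_log 2 (Num.truncn (A ^+ 13)) + 4)%N.
  by move=> a13 ha; apply: rat_bits_int_leX => //; exact: norm_leX_weak ha.
have Bk j i : `|(center j 0 i)%:~R : R| <= A ^+ 2.
  apply: le_trans hn; rewrite mxE -!pmulrn !normr_nat ler_nat.
  have := ltn_ord (j i); rewrite /N; lia.
apply: max_cones_net_bits.
- by apply: (B 0%N 0) => //; rewrite normr0 expr0.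
- by apply: (B 0%N 1) => //; rewrite normr1 expr0.
- by apply: (B 0%N (-1)) => //; rewrite normrN1 expr0.
- exact: B hn.
- apply: (B 8%N) => //; rewrite rmorphN normrN rmorphM /=.
  by apply: (@norm_leX_mul _ _ 1 7) => //; rewrite expr1 normr_nat.
- apply: (B 9%N) => //; rewrite rmorphM /=.
  exact: (@norm_leX_mul _ _ 7 2).
- move=> v i /mapP[j _ ->] /=; apply: (B 2%N) => //.
  by rewrite rmorphN normrN; exact: Bk.
- move=> v /mapP[j _ ->] /=; apply: (B 13%N) => //.
  rewrite rmorphB rmorphM rmorphM rmorphB rmorphM rmorph_sum /=.
  have hfj : `|f (center_pt j)| <= A ^+ 3.
    (* Lipschitz continuity bounds the variation of [f] from the origin by [rho d]. *)
    have -> : f (center_pt j) = f 0 + (f (center_pt j) - f 0) by lra.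
    apply: (@norm_leX_add _ _ 1 2) => //.
    have c0 : in_cube (0 : 'rV[R]_d) by move=> i; rewrite mxE lexx ler01.
    apply: (le_trans (flip _ _ (in_cube_center j) c0)); rewrite subr0.
    have hm : norm1 (center_pt j) <= d%:R.
      rewrite -[X in _ <= X%:R](card_ord d) -sum1_card natr_sum.
      apply: ler_sum => i _.
      by have /andP[? ?] := in_cube_center j i; rewrite ger0_norm.
    apply: (le_trans (ler_wpM2l (ltW rho0) hm)).
    apply: (le_trans (ler_norm _)).
    exact: (@norm_leX_mul _ _ 1 1).
  apply: (@norm_leX_add _ _ 12 10) => //; last first.
    rewrite normrN; apply: (@norm_leX_mul _ _ 7 3) => //.
    apply: (le_trans (ler_norm_sum _ _ _)).
    have hs : \sum_(i < d) `|(center j 0 i)%:~R : R| <= d%:R * A ^+ 2.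
      rewrite mulr_natl -[X in _ <= _ *+ X](card_ord d) -sumr_const.
      by apply: ler_sum => i _.
    apply: (le_trans hs); rewrite [X in _ <= X]exprS ler_wpM2r ?exprn_ge0 //; first lra.
    by rewrite -[A]expr1; apply: le_trans hd; exact: ler_norm.
  apply: (@norm_leX_mul _ _ 2 10) => //.
  apply: (@norm_leX_add _ _ 9 9) => //.
    apply: norm_floor_leX => //; exact: (@norm_leX_mul _ _ 5 3).
  rewrite normrN; exact: (@norm_leX_mul _ _ 5 4).
- apply: rat_bits_natV_leX => //; first by rewrite muln_gt0 q0.
  apply: (@norm_leX_weak _ _ 7) => //; rewrite natrM.
  exact: (@norm_leX_mul _ _ 5 2).
- exact: B hZ.
Qed.

End Grid.

(** * Choice of the parameters and final bounds *)

Theorem theorem3p4 :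
  exists kappa : rat, 0 < kappa /\
  (* universal constants hidden in the O~ : factor C and log exponent k *)
  exists (C : rat) (k : nat), 0 < C /\
  forall (R : realType) (d : nat) (rho : R) (f : 'rV[R]_d -> R),
    (1 <= d)%N -> 0 < rho -> lipschitz_cube rho f ->
    forall eps1 : R, 0 < eps1 ->
    let Nc : R := d%:R * (ratr kappa * rho * d%:R / eps1 + 1) ^+ d in
    let Lg : R := ln (2 + Nc + rho + eps1^-1 + `|f 0|) in
    exists fhat : relu_net d,
      (net_space fhat)%:R <= ratr C * Nc * Lg ^+ k /\
      (net_time fhat)%:R <= ratr C * Nc * Lg ^+ k /\
      (L1_cube (fun x => (f x - net_eval fhat x)%R) <= eps1%:E)%E /\
      ((d <= 3)%N -> forall x, in_cube x -> `|f x - net_eval fhat x| <= eps1).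
Proof.
(* With factor 4, [N = truncn (4 rho d / eps) + 1] is at most the base of the power in [Nc]. *)
exists 4; split; first by rewrite ltr0n.
(* Space is at most [(26 Lg + 4) * 43 Nc], and [Lg >= 1 / 2] turns this into [34 * 43 = 1462] times
   [Nc Lg]. *)
exists 1500, 1%N; split; first by rewrite ltr0n.
move=> R d rho f d0 rho0 flip eps eps0 Nc Lg.
pose X : R := ratr 4 * rho * d%:R / eps + 1.
have d1 : 1 <= d%:R :> R by rewrite ler1n.
pose y := 4 * rho * d%:R / eps.
have y0 : 0 <= y by rewrite /y divr_ge0 ?mulr_ge0 // ltW.
have XE : X = y + 1 by rewrite /X ratr_nat.
pose N' := Num.truncn y.
have NX : (N'.+1)%:R <= X by rewrite XE -natr1 lerD2r truncn_le.
have X1 : 1 <= X by rewrite XE; lra.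
have NdNc : d%:R * ((N'.+1) ^ d)%N%:R <= Nc.
  by rewrite ler_wpM2l // natrX lerXn2r // ?nnegrE -/X //; lra.
have XNc : X <= Nc.
  have h1 : X <= X ^+ d by rewrite -[X in X <= _]expr1 ler_weXn2l.
  by apply: (le_trans h1); rewrite ler_peMl // exprn_ge0 //; lra.
have dNc : d%:R <= Nc by rewrite ler_peMr // exprn_ege1.
(* The common base: it dominates all the data, and its logarithm is [Lg]. *)
pose A := 2 + Nc + rho + eps^-1 + `|f 0|.
have einv : 0 < eps^-1 by rewrite invr_gt0.
have f00 : 0 <= `|f 0| by [].
have A2 : 2 <= A by rewrite /A; lra.
have A1 : 1 <= A by lra.
have A0 : 0 <= A by lra.
have hd : `|d%:R : R| <= A ^+ 1 by rewrite normr_nat expr1 /A; lra.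
have hN : `|(N'.+1)%:R : R| <= A ^+ 1 by rewrite normr_nat expr1 /A; lra.
have hrho : `|rho| <= A ^+ 1 by rewrite gtr0_norm // expr1 /A; lra.
have heps : `|eps^-1| <= A ^+ 1 by rewrite gtr0_norm // expr1 /A; lra.
have hf0 : `|f 0| <= A ^+ 1 by rewrite expr1 /A; lra.
have h4 : `|4 : R| <= A ^+ 2.
  by rewrite normr_nat; have := lerXn2r 2 (ler0n R 2) A0 A2; lra.
have q0 : 0 <= 4 * d%:R * eps^-1 by rewrite !mulr_ge0 // ltW.
pose q := (Num.truncn (4 * d%:R * eps^-1)).+1.
have hq : `|q%:R : R| <= A ^+ 5.
  apply: norm_truncnS_leX => //.
  by apply: (@norm_leX_mul _ _ 3 1) => //; exact: (@norm_leX_mul _ _ 2 1).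
have rq0 : 0 <= rho * q%:R by rewrite mulr_ge0 // ltW.
(* Rounding the slope up keeps the cones below [f]. *)
pose L : int := (Num.truncn (rho * q%:R)).+1.
have hL : `|L%:~R : R| <= A ^+ 7.
  by apply: norm_truncnS_leX => //; exact: (@norm_leX_mul _ _ 1 5).
have hL2 : rho * q%:R <= L%:~R <= rho * q%:R + 1.
  have /andP[h1 h2] := truncn_itv rq0; rewrite -pmulrn (ltW h2) /=.
  by rewrite -natr1 lerD2r.
pose Z := Num.floor (f 0 - rho * d%:R).
have hZ : `|Z%:~R : R| <= A ^+ 4.
  apply: norm_floor_leX => //; apply: (@norm_leX_add _ _ 1 2) => //.
  by rewrite normrN; exact: (@norm_leX_mul _ _ 1 1).
have approx x : in_cube x ->
    0 <= f x - net_eval (grid_net N' f q L Z) x <= eps.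
  apply: (@grid_net_approx _ _ _ _ rho) => //.
  - by rewrite -ler_pdivrMr // ltW // truncnS_gt.
  - by rewrite -ler_pdivrMr // ltW // truncnS_gt.
  - exact: floor_le.
have bits : net_bits (trunc_log 2 (Num.truncn (A ^+ 13)) + 4) (grid_net N' f q L Z).
  exact: (@grid_net_bits _ _ _ _ rho).
have Lg2 : 1 / 2 <= Lg.
  by apply: (le_trans (ln2_ge_half R)); rewrite /Lg -/A ler_ln ?posrE //; lra.
have time : (net_time (grid_net N' f q L Z))%:R <= 43 * Nc.
  apply: (@le_trans _ _ (43 * (d * N'.+1 ^ d))%N%:R); first by rewrite ler_nat grid_net_time.
  by rewrite !natrM ler_wpM2l // -natrM.
have Nc0 : 0 <= Nc by lra.
have NL := ler_wpM2l Nc0 Lg2.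
exists (grid_net N' f q L Z); rewrite expr1 ratr_nat; split; last split; last split.
- apply: (@le_trans _ _ ((26 * Lg + 4) * (43 * Nc))).
    apply: (@le_trans _ _ ((trunc_log 2 (Num.truncn (A ^+ 13)) + 4)%N *
       net_time (grid_net N' f q L Z))%N%:R); first by rewrite ler_nat net_space_le.
    rewrite natrM ler_pM // natrD lerD2r.
    exact: (trunc_log2_leX 13 A2).
  lra.
- apply: (le_trans time); lra.
(* The uniform bound passes to the integral, the cube having volume 1. *)
- apply: (proj2 (@cube_int_le _ _ _ eps _)) => x hx.
  by have /andP[h1 h2] := approx x hx; rewrite !lee_fin ger0_norm.
- move=> _ x hx; have /andP[h1 h2] := approx x hx; by rewrite ger0_norm.
Qed.
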